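(* Let $\mu$ be a self-similar measure on $\mathbb{R}$. If $\mu$ is a Rajchman measure, then it is pointwise absolutely normal.
   Context: A self-similar IFS is a finite family $\Phi=\{f_1,\dots,f_n\}$ of maps $f_i(x)=r_ix+t_i$ of $\mathbb{R}$ with $0<|r_i|<1$; it is assumed that there are $i\ne j$ such that the fixed points of $f_i$ and $f_j$ differ. A self-similar measure is the unique Borel probability measure $\mu$ with $\mu=\sum_ip_i\,f_i\mu$ for such a $\Phi$ and a strictly positive probability vector $(p_1,\dots,p_n)$, where $f_i\mu$ is the push-forward. $\mu$ is Rajchman if $\int\exp(2\pi iqx)\,d\mu(x)\to0$ as $|q|\to\infty$ ($q\in\mathbb{R}$). For an integer $p\ge2$ let $T_p(x)=px\bmod1$. A real $x$ is $p$-normal if $\{T_p^k(x)\}_{k\in\mathbb{N}}$ equidistributes for Lebesgue measure on $[0,1]$, and absolutely normal if it is $p$-normal for all integers $p\ge2$. $\mu$ is pointwise absolutely normal if $\mu$-a.e. $x$ is absolutely normal. *)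

(* Defs.v *)
From mathcomp Require Import all_boot all_order all_algebra.
From mathcomp Require Import archimedean complex.
From mathcomp Require Import all_classical all_reals all_analysis.

Set Implicit Arguments.
Unset Strict Implicit.
Unset Printing Implicit Defensive.
Import Order.TTheory GRing.Theory Num.Theory.
Import numFieldNormedType.Exports.

Local Open Scope classical_set_scope.
Local Open Scope ring_scope.

Definition simil {R : realType} (r t : R) : R -> R := fun x => r * x + t.

Record self_similar_IFS {R : realType} (n : nat) (r t : 'I_n -> R) : Prop := {
  ratio_neq0 : forall i, 0 < `|r i|;
  ratio_lt1 : forall i, `|r i| < 1;
  distinct_fixpoints : exists i j x y,
    [/\ simil (r i) (t i) x = x, simil (r j) (t j) y = y & x <> y] }.

Record positive_weights {R : realType} (n : nat) (p : 'I_n -> R) : Prop := {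
  weight_gt0 : forall i, 0 < p i;
  weight_sum1 : \sum_(i < n) p i = 1 }.

(* The Borel sets of the real line are the measurable sets of
   [measurableTypeR R].  A probability measure satisfying the invariance
   equation is unique (Hutchinson), so "the" self-similar measure of the system
   is characterized by the equation itself. *)
Definition self_similar_measure {R : realType}
    (mu : probability (measurableTypeR R) R) : Prop :=
  exists (n : nat) (r t p : 'I_n -> R),
    [/\ self_similar_IFS r t, positive_weights p &
      forall A : set (measurableTypeR R), measurable A ->
        mu A = (\sum_(i < n)
          (p i)%:E * pushforward mu (simil (r i) (t i)) A)%E].

(* [\int exp(2 pi i q x) dmu(x)], integrating real and imaginary parts. *)
Definition fourier_transform {R : realType}
    (mu : probability (measurableTypeR R) R) (q : R) : R[i] :=
  Complex (\int[mu]_x cos (2 * pi * q * x)) (\int[mu]_x sin (2 * pi * q * x)).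

Definition rajchman {R : realType}
    (mu : probability (measurableTypeR R) R) : Prop :=
  (ComplexField.Normc.normc (fourier_transform mu q) @[q --> +oo] --> (0 : R)) /\
  (ComplexField.Normc.normc (fourier_transform mu q) @[q --> -oo] --> (0 : R)).

Definition times_mod1 {R : realType} (p : nat) (x : R) : R :=
  p%:R * x - (Num.floor (p%:R * x))%:~R.

(* Weak-* convergence of the empirical measures of [u] to Lebesgue measure on
   [0, 1].  Finitely many terms of [u] outside [0, 1] do not affect it; this
   matters since an orbit of [times_mod1] may start outside the interval. *)
Definition equidistributed01 {R : realType} (u : nat -> R) : Prop :=
  forall f : R -> R, {within `[0, 1], continuous f} ->
    N%:R^-1 * (\sum_(k < N) f (u k)) @[N --> \oo] -->
      \int[lebesgue_measure]_(x in `[0, 1]) f x.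

Definition normal_in_base {R : realType} (p : nat) (x : R) : Prop :=
  equidistributed01 (fun k => iter k (times_mod1 p) x).

Definition absolutely_normal {R : realType} (x : R) : Prop :=
  forall p : nat, (2 <= p)%N -> normal_in_base p x.

Definition pointwise_absolutely_normal {R : realType}
    (mu : probability (measurableTypeR R) R) : Prop :=
  {ae mu, forall x, absolutely_normal x}.

(* Main.v *)
(* Let [S_N] be the sum of [cos (q^k s x + theta_k)] over [k < N].  If [|s|] is
   large, the Rajchman property bounds every [\int cos (q^k s x + beta) dmu] by a
   small [e].  Stop the iterated function system along each branch when the
   contraction ratio drops below about [1 / (q^L |s|)]: on the resulting pieces
   the first [L] terms of [S_N] oscillate by a bounded amount (independent of
   [L]), while the remaining terms form a sum of the same kind at a frequency
   that is still large.  Hence the exponential moments of [S_(mL)] with parameter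
   [e / L] grow at most like [exp (4 e^2 m)], so that [S_(mL) >= 5 e m L] has
   exponentially small probability, and Borel-Cantelli gives Weyl's criterion
   almost everywhere. *)

Require Import Defs.
From mathcomp Require Import all_boot all_order all_algebra.
From mathcomp Require Import all_classical all_reals all_analysis.
From mathcomp Require Import complex measurable_realfun.
From mathcomp Require Import ring lra.

Set Implicit Arguments.
Unset Strict Implicit.
Unset Printing Implicit Defensive.
Import Order.TTheory GRing.Theory Num.Theory.
Import numFieldNormedType.Exports.

Local Open Scope classical_set_scope.
Local Open Scope ring_scope.

(** * Self-similar measures *)

Section Preliminaries.
Context {R : realType}.

(** The obstacle is that successive blocks of [S_N] are not independent under [mu], so their
    exponential moments do not simply multiply. The substitute is the invariance equation: [mu] is a
    weighted average of its images on small pieces, and on such a piece an early block is almost a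
    constant that can be pulled out of the integral. The later blocks then need a bound uniform over
    the pieces. A piece with ratio [rho] and translation [tau] changes the frequency [s] to
    [s * rho] and otherwise only shifts phases, which is why arbitrary phases are carried along from
    the start. The equation is used for integrals only, so overlaps between pieces do no harm. The
    parameter [e / L] balances the costs of a block: the mean of the exponent, its second-order term
    and, for large [L], the oscillation on a piece are all of order [e ^+ 2]. Only upper bounds on
    cosine sums are ever proved: a phase [pi] turns them into lower bounds, and a phase [pi / 2]
    gives the sines. *)

Lemma simil_comp (a u a' u' x : R) :
  simil a u (simil a' u' x) = simil (a * a') (a * u' + u) x.
Proof. by rewrite /simil; ring. Qed.

Lemma continuous_simil (a u : R) : continuous (simil a u).
Proof.
by move=> x; apply: cvgD; [apply: cvgM; [exact: cvg_cst|exact: cvg_id]|exact: cvg_cst].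
Qed.

Lemma measurable_simil (a u : R) :
  measurable_fun setT (simil a u : measurableTypeR R -> measurableTypeR R).
Proof. by apply: continuous_measurable_fun; exact: continuous_simil. Qed.

Lemma measurable_expR_comp (F : R -> R) (a u : R) : continuous F ->
  measurable_fun setT (fun x : measurableTypeR R =>
    expR (F (simil a u x))).
Proof.
move=> cF; apply: continuous_measurable_fun => x.
apply: continuous_comp; last exact: continuous_expR.
by apply: continuous_comp; [exact: continuous_simil|exact: cF].
Qed.

Lemma measurable_norm_gt (a : R) :
  measurable ([set x | a < `|x|] : set (measurableTypeR R)).
Proof.
rewrite -[X in measurable X]setTI.
have -> : [set x : measurableTypeR R | a < `|x|] =
    (fun x : measurableTypeR R => `|x|) @^-1` `]a, +oo[%classic.
  by apply/seteqP; split => x /=; rewrite in_itv/= andbT.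
have mn : measurable_fun setT (fun x : measurableTypeR R => `|x| : measurableTypeR R).
  by apply: continuous_measurable_fun => x; exact: norm_continuous.
by apply: mn => //; exact: measurable_itv.
Qed.

End Preliminaries.

Section SelfSimilar.
Context {R : realType} (mu : probability (measurableTypeR R) R).
Context (n : nat) (r t p : 'I_n -> R).
Hypothesis r_gt0 : forall i, 0 < `|r i|.
Hypothesis r_lt1 : forall i, `|r i| < 1.
Hypothesis p_gt0 : forall i, 0 < p i.
Hypothesis p_sum1 : \sum_(i < n) p i = 1.
Hypothesis mu_inv : forall A : set (measurableTypeR R), measurable A ->
  mu A = (\sum_(i < n) (p i)%:E * pushforward mu (simil (r i) (t i)) A)%E.

Lemma integral_self_similar (F : R -> R) : (forall x, 0 <= F x) ->
  measurable_fun setT (F : measurableTypeR R -> R) ->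
  (\int[mu]_x (F x)%:E
   = \sum_(i < n) (p i)%:E * \int[mu]_x (F (simil (r i) (t i) x))%:E)%E.
Proof.
move=> F0 mF.
have mF' : measurable_fun setT (fun x : measurableTypeR R => (F x)%:E).
  exact/measurable_EFinP.
pose pf i : {measure set (measurableTypeR R) -> \bar R} :=
  measure_function_pushforward__canonical__measure_function_Measure
    mu (measurable_simil (r i) (t i)).
(* [msum] takes a family indexed by natural numbers; indices outside ['I_n] are given the zero
   measure. *)
pose m_ (k : nat) : {measure set (measurableTypeR R) -> \bar R} :=
  if insub k is Some i then mscale (NngNum (ltW (p_gt0 i))) (pf i) else mzero.
have mE i : m_ (nat_of_ord i) = mscale (NngNum (ltW (p_gt0 i))) (pf i).
  by rewrite /m_ valK.
rewrite (eq_measure_integral (msum m_ n)); last first.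
  by move=> A mA _ /=; rewrite mu_inv//; apply: eq_bigr => i _; rewrite mE.
rewrite ge0_integral_measure_sum//; last by move=> x _; rewrite lee_fin.
apply: eq_bigr => i _; rewrite mE ge0_integral_mscale//.
  congr (_ * _)%E; rewrite ge0_integral_pushforward//.
  - exact: measurable_simil.
  - by move=> x _; rewrite lee_fin.
by move=> x _; rewrite lee_fin.
Qed.

Lemma ratio_bounds : exists2 c : R, 0 < c &
  exists2 b : R, 0 < b < 1 & forall i, c <= `|r i| <= b.
Proof.
exists (\big[Num.min/1]_(i < n) `|r i|).
  by apply: lt_bigmin => // i _; exact: r_gt0.
(* The default [2^-1] makes the maximum positive and lies below 1, whatever the index set. *)
exists (\big[Num.max/2^-1]_(i < n) `|r i|).
  apply/andP; split; first by apply: lt_le_trans (bigmax_ge_id _ _ _ _); lra.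
  by apply: bigmax_lt => //; lra.
by move=> i; rewrite bigmin_le_cond//= le_bigmax.
Qed.

(** If the image of [x] under one of the maps has modulus above [a], then [a < b * |x| + T]. The
    weights sum to 1, so this bound survives the averaging. *)
Lemma self_similar_tail (T b a : R) : (forall i, `|t i| <= T) ->
  0 < b -> (forall i, `|r i| <= b) ->
  (mu [set x : R | (a < `|x|)%R] <= mu [set x : R | ((a - T) / b < `|x|)%R])%E.
Proof.
move=> tT b0 rb.
rewrite mu_inv; last exact: measurable_norm_gt.
apply: (@le_trans _ _
  (\sum_(i < n) (p i)%:E * mu [set x : R | ((a - T) / b < `|x|)%R])%E).
  apply: lee_sum => i _; apply: lee_wpmul2l; first by rewrite lee_fin ltW.
  rewrite /pushforward; apply: le_measure; rewrite ?inE.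
  - rewrite -[X in measurable X]setTI; apply: measurable_simil => //.
    exact: measurable_norm_gt.
  - exact: measurable_norm_gt.
  move=> x /=; rewrite /simil => axi.
  rewrite ltr_pdivrMr// ltrBlDr (lt_le_trans axi)//.
  by rewrite (le_trans (ler_normD _ _))// lerD// normrM mulrC ler_wpM2l.
rewrite -ge0_sume_distrl; last by move=> i _; rewrite lee_fin ltW.
by rewrite sumEFin p_sum1 mul1e.
Qed.

(** Beyond [K] the map sending [a] to [(a - T) / b] moves [a] up by at least 1. By the tail estimate
    the mass outside [K] is then at most the mass outside [K + m] for every [m], and the latter
    tends to 0. *)
Lemma compact_support : exists2 K : R, 0 <= K & {ae mu, forall x : R, `|x| <= K}.
Proof.
have [c c0 [b /andP[b0 b1] crb]] := ratio_bounds.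
pose T := \big[Num.max/0]_(i < n) `|t i|.
have T0 : 0 <= T by exact: bigmax_ge_id.
have tT i : `|t i| <= T by exact: le_bigmax.
pose K := (T + 1) / (1 - b).
have b1' : 0 < 1 - b by lra.
have K0 : 0 <= K by rewrite divr_ge0 ?ltW//; lra.
have EK : K * (1 - b) = T + 1 by rewrite /K divfK// gt_eqF.
exists K => //.
pose S (a : R) := [set x : measurableTypeR R | a < `|x|].
have mS a : measurable (S a) by exact: measurable_norm_gt.
have step m : (mu (S K) <= mu (S (K + m%:R)%R))%E.
  elim: m => [|m IH]; first by rewrite addr0.
  apply: (le_trans IH).
  apply: (le_trans (self_similar_tail _ tT b0 (fun i => proj2 (andP (crb i))))).
  apply: le_measure; rewrite ?inE; [exact: mS|exact: mS|].
  move=> x /=; apply: le_lt_trans; rewrite ler_pdivlMr// -natr1.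
  have m0 : 0 <= m%:R :> R by [].
  nra.
have : mu (S (K + m%:R)) @[m --> \oo] --> mu (\bigcap_m S (K + m%:R)).
  apply: nonincreasing_cvg_mu => //.
  - by rewrite (le_lt_trans (probability_le1 _ _)) ?ltry.
  - exact: bigcapT_measurable.
  - move=> m k mk; apply/subsetPset => x /=; apply: le_lt_trans.
    by rewrite lerD2l ler_nat.
rewrite (_ : \bigcap_m _ = set0); last first.
  apply/seteqP; split => // x /(_ (Num.bound `|x|) I)/=.
  rewrite /S/= ltNge => /negP; apply.
  by rewrite (le_trans (ltW (archi_boundP (normr_ge0 x))))// ler_wpDl.
rewrite measure0 => h.
exists (S K); split => //.
- apply/eqP; rewrite eq_le measure_ge0 andbT.
  rewrite -(cvg_lim _ h)//; apply: lime_ge; first by apply/cvg_ex; exists 0%E.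
  exact: nearW.
- by move=> x /=; rewrite /S/= ltNge => /negP.
Qed.

End SelfSimilar.

(** * Decoupling two functions along the pieces of the measure *)

Section Cascade.
Context {R : realType} (mu : probability (measurableTypeR R) R).
Context (n : nat) (r t p : 'I_n -> R) (c b K : R).
Hypothesis p_gt0 : forall i, 0 < p i.
Hypothesis c_gt0 : 0 < c.
Hypothesis b_01 : 0 < b < 1.
Hypothesis r_bounds : forall i, c <= `|r i| <= b.
Hypothesis mu_inv : forall F : R -> R, (forall x, 0 <= F x) ->
  measurable_fun setT (F : measurableTypeR R -> R) ->
  (\int[mu]_x (F x)%:E
   = \sum_(i < n) (p i)%:E * \int[mu]_x (F (simil (r i) (t i) x))%:E)%E.
Hypothesis K_ge0 : 0 <= K.
Hypothesis mu_supp : {ae mu, forall x : R, `|x| <= K}.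
Context (A B : R -> R) (C Z eta : R).
(* [A] is nearly constant on pieces of ratio at most [eta]; the exponential
   moment of [B] is controlled on pieces of ratio at least [c * eta]. *)
Hypothesis contA : continuous A.
Hypothesis contB : continuous B.
Hypothesis Z_ge0 : 0 <= Z.
Hypothesis eta_gt0 : 0 < eta.
Hypothesis A_osc : forall rho tau x y, `|rho| <= eta -> `|x| <= K -> `|y| <= K ->
  A (simil rho tau x) <= A (simil rho tau y) + C.
Hypothesis B_bound : forall rho tau, c * eta <= `|rho| ->
  (\int[mu]_x (expR (B (simil rho tau x)))%:E <= Z%:E)%E.

(** On the support, [A] stays within [C] of its value [a] at the base point [0] of the piece.
    Replacing [A] by [a + C] lets the moment of [B] be bounded by [Z]; returning from [a - C] to [A]
    costs [C] a second time. *)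
Lemma cascade_small rho tau : c * eta <= `|rho| -> `|rho| <= eta ->
  (\int[mu]_x (expR (A (simil rho tau x) + B (simil rho tau x)))%:E <=
   (Z * expR (C + C))%:E * \int[mu]_x (expR (A (simil rho tau x)))%:E)%E.
Proof.
move=> rho1 rho2; set a := A (simil rho tau 0).
have mE (F : R -> R) : continuous F -> measurable_fun setT (fun x : measurableTypeR R =>
    (expR (F (simil rho tau x)))%:E).
  by move=> cF; apply/measurable_EFinP; exact: (measurable_expR_comp rho tau cF).
have cAB : continuous (A \+ B) by move=> x; apply: cvgD; [exact: contA|exact: contB].
have K0 : `|0 : R| <= K by rewrite normr0.
apply: (@le_trans _ _ ((expR (a + C))%:E * \int[mu]_x (expR (B (simil rho tau x)))%:E)%E).
  rewrite -ge0_integralZl ?lee_fin ?expR_ge0//; last exact: (mE B contB).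
  apply: ae_ge0_le_integral => //.
  - exact: (mE _ cAB).
  - by apply: measurable_funeM; exact: (mE B contB).
  apply: (@filterS _ _ (ae_filter_ringOfSetsType mu) _ _ _ mu_supp) => x xK _.
  by rewrite -EFinM lee_fin -expRD ler_expR lerD2r; exact: A_osc.
apply: (@le_trans _ _ ((expR (a + C))%:E * Z%:E)%E).
  by apply: lee_wpmul2l; [rewrite lee_fin expR_ge0|exact: B_bound].
rewrite -EFinM (_ : expR (a + C) * Z = (Z * expR (C + C)) * expR (a - C)); last first.
  by rewrite -mulrA -expRD mulrC; congr (_ * expR _); ring.
rewrite EFinM; apply: lee_wpmul2l; first by rewrite lee_fin mulr_ge0// expR_ge0.
have -> : ((expR (a - C))%:E = \int[mu]_x (cst (expR (a - C))%:E x))%E.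
  by rewrite integral_cst//= (probability_setT mu) mule1.
apply: ae_ge0_le_integral => //.
  by move=> x _; rewrite lee_fin expR_ge0.
  exact: (mE A contA).
apply: (@filterS _ _ (ae_filter_ringOfSetsType mu) _ _ _ mu_supp) => x xK _.
by rewrite lee_fin ler_expR lerBlDr; exact: A_osc.
Qed.

(** The invariance equation splits both integrals over the children of a piece with the same
    weights, so the inequality passes from children to parent with an unchanged constant: no loss
    accumulates over the generations. *)
Lemma cascade rho tau : c * eta <= `|rho| ->
  (\int[mu]_x (expR (A (simil rho tau x) + B (simil rho tau x)))%:E <=
   (Z * expR (C + C))%:E * \int[mu]_x (expR (A (simil rho tau x)))%:E)%E.
Proof.
have [b0 b1] := andP b_01.
move=> rho1; have [m rhom] : exists m : nat, `|rho| * b ^+ m <= eta.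
  have : (fun m => `|rho| * b ^+ m) @ \oo --> `|rho| * 0.
    by apply: cvgM; [exact: cvg_cst|apply: cvg_expr; rewrite ger0_norm// ltW].
  rewrite mulr0 => /cvgrPdist_lt/(_ _ eta_gt0)[m _ /(_ m (leqnn m))].
  by rewrite sub0r normrN => h; exists m; exact: le_trans (ler_norm _) (ltW h).
(* Pieces of ratio above [eta] are subdivided; children have ratio at least
   [c * eta], and [m] bounds the number of generations needed. *)
elim: m rho tau rho1 rhom => [|m IH] rho tau rho1 rhom.
  by apply: cascade_small => //; rewrite expr0 mulr1 in rhom.
have [rho2|rho2] := leP `|rho| eta; first exact: cascade_small.
have cAB : continuous (A \+ B) by move=> x; apply: cvgD; [exact: contA|exact: contB].
rewrite (mu_inv
  (F := fun x => expR (A (simil rho tau x) + B (simil rho tau x)))); last 2 first.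
- by move=> x; rewrite expR_ge0.
- exact: (measurable_expR_comp rho tau cAB).
rewrite (mu_inv (F := fun x => expR (A (simil rho tau x)))); last 2 first.
- by move=> x; rewrite expR_ge0.
- exact: (measurable_expR_comp rho tau contA).
rewrite ge0_sume_distrr; last first.
  move=> i _; rewrite mule_ge0 ?lee_fin ?(ltW (p_gt0 _))//.
  by apply: integral_ge0 => x _; rewrite lee_fin expR_ge0.
apply: lee_sum => i _; rewrite muleCA; apply: lee_wpmul2l; first by rewrite lee_fin ltW.
have /andP[ci bi] := r_bounds i.
under eq_integral do rewrite !simil_comp.
under [in leRHS]eq_integral do rewrite !simil_comp.
apply: IH; rewrite normrM.
- by rewrite mulrC; apply: ler_pM => //; exact: ltW.
- apply: le_trans rhom; rewrite exprS mulrA.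
  by apply: ler_wpM2r; [rewrite exprn_ge0// ltW|rewrite ler_wpM2l].
Qed.

End Cascade.

(** * Exponential moments of cosine sums *)

Section CosSum.
Context {R : realType}.
Implicit Types (s x y : R) (theta : nat -> R).

Lemma cos_lipschitz x y : `|cos x - cos y| <= `|x - y|.
Proof.
wlog xy : x y / x < y.
  move=> h; case: (ltgtP x y) => [/h//|/h|->]; last by rewrite !subrr normr0.
  by rewrite distrC [leRHS]distrC.
have [|z _ h] := @MVT R cos (fun z => - sin z) x y xy (fun z _ => is_derive_cos z).
  by apply: continuous_subspaceT; exact: continuous_cos.
rewrite distrC h [leRHS]distrC normrM normrN ler_piMl//; exact: sin_max.
Qed.

(** The free phases make this class stable under composition with a similarity and under dropping
    initial terms. *)
Definition cos_sum (p N : nat) s theta x : R :=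
  \sum_(k < N) cos (p%:R ^+ k * s * x + theta k).

Lemma cos_sum_simil p N s theta rho tau x :
  cos_sum p N s theta (simil rho tau x)
  = cos_sum p N (s * rho) (fun k => p%:R ^+ k * s * tau + theta k) x.
Proof. by apply: eq_bigr => k _; rewrite /simil; congr cos; ring. Qed.

Lemma cos_sumD p L N s theta x :
  cos_sum p (L + N) s theta x = cos_sum p L s theta x
    + cos_sum p N (p%:R ^+ L * s) (fun k => theta (L + k)%N) x.
Proof.
rewrite /cos_sum big_split_ord/=; congr (_ + _); apply: eq_bigr => k _.
by congr cos; rewrite exprD; ring.
Qed.

Lemma cos_sum_norm p N s theta x : `|cos_sum p N s theta x| <= N%:R.
Proof.
rewrite (le_trans (ler_norm_sum _ _ _))// -[leRHS]mulr1 -[N in leRHS]card_ord.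
rewrite mulr_natl -sumr_const; apply: ler_sum => k _; exact: cos_max.
Qed.

Lemma continuous_cos_affine (a b : R) : continuous (fun x : R => cos (a * x + b)).
Proof.
move=> x; apply: continuous_comp; last exact: continuous_cos.
by apply: cvgD; [apply: cvgM; [exact: cvg_cst|exact: cvg_id]|exact: cvg_cst].
Qed.

Lemma continuous_cos_sum p N s theta : continuous (cos_sum p N s theta).
Proof.
elim: N => [|N IH] x.
  rewrite (_ : cos_sum _ _ _ _ = cst 0); first exact: cvg_cst.
  by apply/funext => z; rewrite /cos_sum big_ord0.
rewrite (_ : cos_sum _ _ _ _ =
  cos_sum p N s theta \+ (fun z => cos (p%:R ^+ N * s * z + theta N))).
  by apply: cvgD; [exact: IH|exact: continuous_cos_affine].
by apply/funext => z; rewrite /cos_sum big_ord_recr.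
Qed.

Lemma sum_expr_le p L : (2 <= p)%N -> \sum_(k < L) (p%:R ^+ k : R) <= p%:R ^+ L.
Proof.
move=> p2; have p2' : 2 <= p%:R :> R by rewrite ler_nat.
elim: L => [|L IH]; first by rewrite big_ord0 expr0.
have : 0 <= p%:R ^+ L :> R by rewrite exprn_ge0.
by rewrite big_ord_recr/= exprS; nra.
Qed.

(** The Lipschitz constants of the terms grow geometrically, so their sum is comparable with the
    last one and no factor [L] appears. *)
Lemma cos_sum_osc p L s theta x y : (2 <= p)%N ->
  `|cos_sum p L s theta x - cos_sum p L s theta y| <= p%:R ^+ L * (`|s| * `|x - y|).
Proof.
move=> p2; rewrite /cos_sum -sumrB.
rewrite (le_trans (ler_norm_sum _ _ _))//.
apply: (@le_trans _ _ (\sum_(k < L) p%:R ^+ k * (`|s| * `|x - y|))).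
  apply: ler_sum => k _; rewrite (le_trans (cos_lipschitz _ _))//.
  rewrite opprD addrACA subrr addr0 -mulrBr !normrM ger0_norm ?exprn_ge0//.
  by rewrite mulrA.
by rewrite -mulr_suml ler_wpM2r ?sum_expr_le// mulr_ge0.
Qed.

(** From [1 - u <= expR (- u)] one gets [expR u <= (1 - u)^-1], and [(1 + u + 2 * u ^+ 2) * (1 - u)]
    is at least 1 when [u <= 2^-1]. *)
Lemma expR_le_quadratic (u : R) : u <= 2^-1 -> expR u <= 1 + u + 2 * u ^+ 2.
Proof.
move=> u2; have h : 1 - u <= expR (- u) by exact: expR_ge1Dx.
have u1 : 0 < 1 - u by lra.
rewrite -[expR u]invrK -expRN; apply: (@le_trans _ _ (1 - u)^-1).
  by rewrite lef_pV2 ?posrE// expR_gt0.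
rewrite -[leLHS]mul1r ler_pdivrMr//.
have -> : (1 + u + 2 * u ^+ 2) * (1 - u) = 1 + u ^+ 2 * (1 - 2 * u) by ring.
by rewrite lerDl mulr_ge0 ?sqr_ge0//; lra.
Qed.

End CosSum.

Section ExpMoment.
Context {R : realType} (mu : probability (measurableTypeR R) R).

Lemma integrable_continuous_bounded (F : R -> R) (M : R) : continuous F ->
  (forall x, `|F x| <= M) -> mu.-integrable setT (EFin \o F).
Proof.
move=> cF FM; apply: measurable_bounded_integrable => //.
- by rewrite (le_lt_trans (probability_le1 _ _)) ?ltry.
- exact: continuous_measurable_fun.
- exists M; split; first exact: num_real.
  by move=> z Mz x _ /=; exact: le_trans (FM x) (ltW Mz).
Qed.

Lemma Rintegral_cos_sum_le (p N : nat) (s : R) (theta : nat -> R) (e : R) :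
  (forall k b, \int[mu]_x cos (p%:R ^+ k * s * x + b) <= e) ->
  \int[mu]_x cos_sum p N s theta x <= N%:R * e.
Proof.
move=> he; elim: N => [|N IH].
  rewrite mul0r (eq_Rintegral _ (g := cst 0)); last first.
    by move=> x _; rewrite /cos_sum big_ord0.
  by rewrite Rintegral_cst// mul0r.
have -> : \int[mu]_x cos_sum p N.+1 s theta x =
    \int[mu]_x (cos_sum p N s theta x + cos (p%:R ^+ N * s * x + theta N)).
  by apply: eq_Rintegral => x _; rewrite /cos_sum big_ord_recr.
rewrite RintegralD//.
- by rewrite -natr1 mulrDl mul1r lerD.
- apply: (integrable_continuous_bounded (M := N%:R)); last exact: cos_sum_norm.
  exact: continuous_cos_sum.
- apply: (integrable_continuous_bounded (M := 1)); last by move=> x; exact: cos_max.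
  exact: continuous_cos_affine.
Qed.

(** The exponent lies in [[- e, e]], so the quadratic bound on the exponential applies. Its linear
    term integrates to at most [e / L * (L * e) = e ^+ 2], and its quadratic term contributes at
    most [2 * e ^+ 2]. *)
Lemma expR_cos_sum_le (p L : nat) (s : R) (theta : nat -> R) (e : R) :
  (forall k b, \int[mu]_x cos (p%:R ^+ k * s * x + b) <= e) ->
  (0 < L)%N -> 0 < e <= 2^-1 ->
  (\int[mu]_x (expR (e / L%:R * cos_sum p L s theta x))%:E
    <= (expR (3 * e ^+ 2))%:E)%E.
Proof.
move=> he L0 /andP[e0 e1]; set l := e / L%:R.
have L0' : 0 < L%:R :> R by rewrite ltr0n.
have l0 : 0 < l by rewrite divr_gt0.
have lL : l * L%:R = e by rewrite /l divfK// gt_eqF.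
pose g x := (1 + 2 * e ^+ 2) + l * cos_sum p L s theta x.
have lS x : `|l * cos_sum p L s theta x| <= e.
  by rewrite normrM gtr0_norm// -lL ler_wpM2l ?(ltW l0)// cos_sum_norm.
have cS : continuous (fun x => l * cos_sum p L s theta x).
  by move=> x; apply: cvgM; [exact: cvg_cst|exact: continuous_cos_sum].
have iS : mu.-integrable setT (EFin \o (fun x => l * cos_sum p L s theta x)).
  exact: (integrable_continuous_bounded cS lS).
have iS1 : mu.-integrable setT (EFin \o cos_sum p L s theta).
  apply: (integrable_continuous_bounded (M := L%:R)); last exact: cos_sum_norm.
  exact: continuous_cos_sum.
have cg : continuous g.
  by move=> x; apply: cvgD; [exact: cvg_cst|exact: cS].
have gM x : `|g x| <= 1 + 2 * e ^+ 2 + e.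
  rewrite (le_trans (ler_normD _ _))// lerD// ger0_norm//.
  by rewrite addr_ge0// mulr_ge0// sqr_ge0.
have ig : mu.-integrable setT (EFin \o g) by exact: integrable_continuous_bounded cg gM.
have eg x : expR (l * cos_sum p L s theta x) <= g x.
  have /andP[_ h2] : - e <= l * cos_sum p L s theta x <= e by rewrite -ler_norml.
  rewrite (le_trans (expR_le_quadratic _)) ?(le_trans h2)// /g.
  rewrite addrAC lerD2r lerD2l ler_wpM2l//.
  by rewrite -real_normK ?num_real// lerXn2r ?nnegrE// ltW.
apply: (@le_trans _ _ (\int[mu]_x (g x)%:E)%E).
  apply: ge0_le_integral => //.
  - apply/measurable_EFinP; apply: continuous_measurable_fun => x.
    by apply: continuous_comp; [exact: cS|exact: continuous_expR].
  - by apply/measurable_EFinP; exact: continuous_measurable_fun.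
  - by move=> x _; rewrite lee_fin.
have -> : (\int[mu]_x (g x)%:E = (\int[mu]_x g x)%:E)%E.
  by rewrite /Rintegral fineK//; exact: integrable_fin_num ig.
rewrite lee_fin /g RintegralD//; last first.
  apply: (integrable_continuous_bounded (M := `|1 + 2 * e ^+ 2|)) => //.
  by move=> x; exact: cvg_cst.
rewrite RintegralZl// Rintegral_cst//= (probability_setT mu) mulr1.
apply: le_trans (expR_ge1Dx _).
have : l * (\int[mu]_x cos_sum p L s theta x) <= l * (L%:R * e).
  by rewrite ler_wpM2l ?(ltW l0)//; exact: Rintegral_cos_sum_le.
rewrite mulrA lL; nra.
Qed.

End ExpMoment.

(** * Large deviations and almost sure bounds *)

Section Markov.
Context {R : realType} (mu : probability (measurableTypeR R) R).

Lemma measurable_ge_continuous (F : R -> R) (a : R) : continuous F ->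
  measurable ([set x | a <= F x] : set (measurableTypeR R)).
Proof.
move=> cF; have -> : [set x : measurableTypeR R | a <= F x] =
    setT `&` ((F : measurableTypeR R -> R) @^-1` `[a, +oo[%classic).
  by rewrite setTI; apply/seteqP; split => x /=; rewrite in_itv/= andbT.
exact: (continuous_measurable_fun cF).
Qed.

Lemma exp_markov (F : R -> R) (l a : R) : 0 <= l -> continuous F ->
  (mu [set x : R | (a <= F x)%R] <=
    (expR (- (l * a)))%:E * \int[mu]_x (expR (l * F x))%:E)%E.
Proof.
move=> l0 cF; have mS := measurable_ge_continuous a cF.
have mF : measurable_fun setT (fun x : measurableTypeR R => (expR (l * F x))%:E).
  apply/measurable_EFinP; apply: continuous_measurable_fun => x.
  apply: continuous_comp; last exact: continuous_expR.
  by apply: cvgM; [exact: cvg_cst|exact: cF].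
set S := [set x : R | a <= F x].
rewrite expRN lee_pdivlMl ?expR_gt0//.
apply: (@le_trans _ _ (\int[mu]_(x in S) (cst (expR (l * a))%:E x))%E).
  by rewrite integral_cst.
apply: (@le_trans _ _ (\int[mu]_(x in S) (expR (l * F x))%:E)%E).
  apply: ge0_le_integral => //.
  - by move=> x _; rewrite lee_fin expR_ge0.
  - exact: measurable_funTS mF.
  - by move=> x Sx; rewrite lee_fin ler_expR ler_wpM2l.
by apply: ge0_subset_integral.
Qed.

End Markov.

Section Decay.
Context {R : realType} (mu : probability (measurableTypeR R) R).
Context (n : nat) (r t p : 'I_n -> R) (c b K : R).
Hypothesis p_gt0 : forall i, 0 < p i.
Hypothesis c_gt0 : 0 < c.
Hypothesis b_01 : 0 < b < 1.
Hypothesis r_bounds : forall i, c <= `|r i| <= b.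
Hypothesis mu_inv : forall F : R -> R, (forall x, 0 <= F x) ->
  measurable_fun setT (F : measurableTypeR R -> R) ->
  (\int[mu]_x (F x)%:E
   = \sum_(i < n) (p i)%:E * \int[mu]_x (F (simil (r i) (t i) x))%:E)%E.
Hypothesis K_ge0 : 0 <= K.
Hypothesis mu_supp : {ae mu, forall x : R, `|x| <= K}.
Context (q L : nat) (kappa e : R).
Hypothesis q_ge2 : (2 <= q)%N.
Hypothesis kappa_gt0 : 0 < kappa.
Hypothesis decay : forall s beta, kappa <= `|s| ->
  \int[mu]_x cos (s * x + beta) <= e.
Hypothesis e_small : 0 < e <= 2^-1.
Hypothesis L_gt0 : (0 < L)%N.
Hypothesis L_large : 4 * K * (kappa / c) <= e * L%:R.
Local Notation l := (e / L%:R).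

Let e_gt0 : 0 < e. Proof. by case/andP: e_small. Qed.
Let LR_gt0 : 0 < L%:R :> R. Proof. by rewrite ltr0n. Qed.
Let l_gt0 : 0 < l. Proof. exact: divr_gt0. Qed.

(** Each new block of length [L] multiplies the bound by [expR (4 * e ^+ 2)]: [3 * e ^+ 2] is its
    own moment, and twice [e ^+ 2 / 2] is the price of decoupling it from the later blocks. The
    induction is over all [s] and [theta], since both change on a piece. *)
Lemma expR_moment_bound (m : nat) (s : R) (theta : nat -> R) : kappa <= `|s| ->
  (\int[mu]_x (expR (l * cos_sum q (m * L) s theta x))%:E
    <= (expR (4 * e ^+ 2 * m%:R))%:E)%E.
Proof.
elim: m s theta => [|m IH] s theta s_large.
  under eq_integral do rewrite /cos_sum mul0n big_ord0 mulr0.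
  by rewrite integral_cst//= (probability_setT mu) mule1 mulr0.
have q1 : 1 <= q%:R :> R by rewrite ler1n ltnW.
have qL1 : 1 <= q%:R ^+ L :> R by exact: exprn_ege1.
have qL0 : 0 < q%:R ^+ L :> R by exact: lt_le_trans ltr01 qL1.
have s0 : 0 < `|s| by exact: lt_le_trans s_large.
(* Chosen so that on a piece of the least allowed ratio [c * eta] the frequency [q ^ L * s] of the
   later blocks still has modulus at least [kappa]. *)
pose eta := kappa / (c * q%:R ^+ L * `|s|).
have eta0 : 0 < eta by rewrite divr_gt0// !mulr_gt0.
have ceta : c * eta * (q%:R ^+ L * `|s|) = kappa.
  by rewrite /eta; field; rewrite !gt_eqF.
pose A x := l * cos_sum q L s theta x.
pose B x := l * cos_sum q (m * L) (q%:R ^+ L * s) (fun k => theta (L + k)%N) x.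
have cont N u f : continuous (fun x : R => l * cos_sum q N u f x).
  by move=> x; apply: cvgM; [exact: cvg_cst|exact: continuous_cos_sum].
have AB x : l * cos_sum q (m.+1 * L) s theta x = A (simil 1 0 x) + B (simil 1 0 x).
  by rewrite mulSn cos_sumD mulrDr /A /B /simil mul1r addr0.
under eq_integral do rewrite AB.
(* The first block oscillates by at most [2 * K * (kappa / c)] on such a piece; [L_large] is what
   brings this, times [e / L], below [e ^+ 2 / 2]. *)
have osc rho tau x y : `|rho| <= eta -> `|x| <= K -> `|y| <= K ->
    A (simil rho tau x) <= A (simil rho tau y) + e ^+ 2 / 2.
  move=> rho_s xK yK; rewrite -lerBlDl /A -mulrBr.
  apply: (@le_trans _ _ (l * (q%:R ^+ L * (`|s| * (eta * (K + K)))))).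
    rewrite ler_wpM2l ?(ltW l_gt0)// (le_trans (ler_norm _))//.
    rewrite (le_trans (cos_sum_osc _ _ _ _ _ _))//.
    rewrite ler_wpM2l ?(ltW qL0)// ler_wpM2l//.
    rewrite /simil opprD addrACA subrr addr0 -mulrBr normrM ler_pM//.
    by rewrite (le_trans (ler_normB _ _))// lerD.
  have -> : q%:R ^+ L * (`|s| * (eta * (K + K))) = 4 * K * (kappa / c) / 2.
    by rewrite -ceta; field; rewrite gt_eqF.
  rewrite mulrA ler_pM2r ?invr_gt0//.
  apply: (@le_trans _ _ (l * (e * L%:R))); first by rewrite ler_wpM2l ?(ltW l_gt0).
  by rewrite le_eqVlt; apply/orP; left; apply/eqP; field; rewrite gt_eqF.
have Bb rho tau : c * eta <= `|rho| ->
    (\int[mu]_x (expR (B (simil rho tau x)))%:E <= (expR (4 * e ^+ 2 * m%:R))%:E)%E.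
  move=> rho_l; rewrite /B; under eq_integral do rewrite cos_sum_simil.
  apply: IH; rewrite !normrM (ger0_norm (ltW qL0)) -ceta mulrC.
  by rewrite ler_wpM2l// mulr_ge0 ?(ltW qL0).
(* The whole measure is the piece [simil 1 0]; it is admissible because [kappa <= |s|] forces
   [c * eta <= 1]. *)
have := @cascade R mu n r t p c b K p_gt0 c_gt0 b_01 r_bounds mu_inv K_ge0
  mu_supp A B _ _ eta (cont _ _ _) (cont _ _ _) (expR_ge0 _) eta0 osc Bb 1 0.
rewrite normr1 => /(_ _)/le_trans; apply.
  rewrite -(@ler_pM2r _ (q%:R ^+ L * `|s|)) ?mulr_gt0// ceta mul1r.
  by rewrite (le_trans s_large)// ler_peMl.
apply: (@le_trans _ _ ((expR (4 * e ^+ 2 * m%:R) * expR (e ^+ 2 / 2 + e ^+ 2 / 2))%:E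
    * (expR (3 * e ^+ 2))%:E)%E).
  apply: lee_wpmul2l; first by rewrite lee_fin mulr_ge0 ?expR_ge0.
  under eq_integral do rewrite /A /simil mul1r addr0.
  apply: expR_cos_sum_le => // k beta; apply: decay.
  rewrite normrM (le_trans s_large)// ler_peMl// normrX ger0_norm ?ler0n//.
  exact: exprn_ege1.
rewrite -EFinM lee_fin -!expRD ler_expR -natr1.
by rewrite le_eqVlt; apply/orP; left; apply/eqP; field.
Qed.

(** In Markov's inequality the threshold contributes [- 5 * e ^+ 2 * m] to the exponent and the
    moment [4 * e ^+ 2 * m], which leaves a geometric rate. *)
Lemma cos_sum_tail (m : nat) (s : R) (theta : nat -> R) : kappa <= `|s| ->
  (mu [set x : R | (5 * e * (m * L)%:R <= cos_sum q (m * L) s theta x)%R]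
    <= (expR (- (e ^+ 2)) ^+ m)%:E)%E.
Proof.
move=> s_large.
have h := @exp_markov R mu (cos_sum q (m * L) s theta) l (5 * e * (m * L)%:R)
  (ltW l_gt0) (@continuous_cos_sum _ _ _ _ _).
apply: (le_trans h).
apply: (@le_trans _ _ ((expR (- (l * (5 * e * (m * L)%:R))))%:E
    * (expR (4 * e ^+ 2 * m%:R))%:E)%E).
  by apply: lee_wpmul2l; [rewrite lee_fin expR_ge0|exact: expR_moment_bound].
rewrite -EFinM lee_fin -expRD -expRM_natl ler_expR natrM.
by rewrite le_eqVlt; apply/orP; left; apply/eqP; field; rewrite gt_eqF.
Qed.

Lemma ae_cos_sum_multiples (s : R) (theta : nat -> R) : kappa <= `|s| ->
  {ae mu, forall x : R, exists m0, forall m, (m0 <= m)%N ->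
    cos_sum q (m * L) s theta x <= 5 * e * (m * L)%:R}.
Proof.
move=> s_large.
pose F m := [set x : measurableTypeR R |
  5 * e * (m * L)%:R <= cos_sum q (m * L) s theta x].
have mF m : measurable (F m).
  exact: (@measurable_ge_continuous R (cos_sum q (m * L) s theta) _
    (@continuous_cos_sum _ _ _ _ _)).
pose z : R := expR (- (e ^+ 2)).
have z0 : 0 < z by exact: expR_gt0.
have z1 : z < 1 by rewrite /z expR_lt1 oppr_lt0 exprn_gt0.
have sumF : (\sum_(m <oo) mu (F m) < +oo)%E.
  apply: (@le_lt_trans _ _ ((1 - z)^-1)%:E); last exact: ltry.
  apply: lime_le; first by apply: is_cvg_nneseries => m _ _; exact: measure_ge0.
  apply: nearW => N.
  apply: (@le_trans _ _ (\sum_(0 <= m < N) (geometric 1 z m)%:E)%E).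
    by apply: lee_sum => m _; rewrite /geometric/= mul1r; exact: cos_sum_tail.
  rewrite sumEFin lee_fin.
  have := geometric_le_lim N ler01 z0; rewrite gtr0_norm// => /(_ z1).
  by rewrite /series/= mul1r.
have lim0 := lim_sup_set_cvg0 mF sumF.
exists (lim_sup_set F); split => //.
  by apply: bigcap_measurable => // m _; exact: bigcup_measurable.
move=> x /= /forallNP Hx m0 _; have /existsNP[m /not_implyP[m0m /negP]] := Hx m0.
by rewrite -ltNge => /ltW h; exists m.
Qed.

(** The incomplete last block has fewer than [L] terms, hence costs at most one further [e * N] for
    large [N]. *)
Lemma ae_cos_sum_large_scale (s : R) (theta : nat -> R) : kappa <= `|s| ->
  {ae mu, forall x : R, \forall N \near \oo,
    cos_sum q N s theta x <= 6 * e * N%:R}.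
Proof.
move=> s_large.
apply: (@filterS _ _ (ae_filter_ringOfSetsType mu) _ _ _
  (ae_cos_sum_multiples theta s_large)) => x [m0 hm0].
exists (m0 * L + Num.bound (L%:R / e))%N => // N /= hN.
have eN : L%:R <= e * N%:R.
  rewrite mulrC -ler_pdivrMr//.
  have h0 : 0 <= L%:R / e by rewrite divr_ge0// ltW.
  rewrite (le_trans (ltW (archi_boundP h0)))// ler_nat.
  exact: leq_trans (leq_addl _ _) hN.
have m0N : (m0 <= N %/ L)%N.
  by rewrite leq_divRL//; exact: leq_trans (leq_addr _ _) hN.
rewrite {1}(divn_eq N L) cos_sumD.
have h1 := hm0 _ m0N.
set a := cos_sum q (N %/ L * L) _ _ _; set a' := cos_sum q (N %% L) _ _ _.
have h2 : a' <= L%:R.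
  rewrite (le_trans (ler_norm _))// (le_trans (cos_sum_norm _ _ _ _ _))//.
  by rewrite ler_nat ltnW// ltn_mod.
have h3 : (N %/ L * L)%:R <= N%:R :> R by rewrite ler_nat leq_trunc_div.
have h4 : 5 * e * (N %/ L * L)%:R <= 5 * e * N%:R.
  by rewrite ler_wpM2l// mulr_ge0// ltW.
move: h1; rewrite -/a; lra.
Qed.

(** Dropping the first [k0] terms replaces [s] by [q ^ k0 * s], which is large; the dropped terms
    account for the seventh [e * N]. *)
Lemma ae_cos_sum_small (s : R) (theta : nat -> R) : s != 0 ->
  {ae mu, forall x : R, \forall N \near \oo,
    cos_sum q N s theta x <= 7 * e * N%:R}.
Proof.
move=> s0; have [k0 s_large] : exists k0, kappa <= `|q%:R ^+ k0 * s|.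
  have s0' : 0 < `|s| by rewrite normr_gt0.
  have h0 : 0 <= kappa / `|s| by rewrite divr_ge0// ltW.
  exists (Num.bound (kappa / `|s|)).
  rewrite normrM -ler_pdivrMr// (le_trans (ltW (archi_boundP h0)))//.
  rewrite ger0_norm ?exprn_ge0// -natrX ler_nat.
  by rewrite ltnW// ltn_expl.
apply: (@filterS _ _ (ae_filter_ringOfSetsType mu) _ _ _
  (ae_cos_sum_large_scale (fun k => theta (k0 + k)%N) s_large)) => x [N0 _ hN0].
exists (k0 + N0 + Num.bound (k0%:R / e))%N => // N /= hN.
have k0N : (k0 <= N)%N by apply: leq_trans hN; rewrite -addnA leq_addr.
have eN : k0%:R <= e * N%:R.
  rewrite mulrC -ler_pdivrMr//.
  have h0 : 0 <= k0%:R / e by rewrite divr_ge0// ltW.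
  rewrite (le_trans (ltW (archi_boundP h0)))// ler_nat.
  exact: leq_trans (leq_addl _ _) hN.
have N0N : (N0 <= N - k0)%N.
  by rewrite leq_subRL//; apply: leq_trans hN; rewrite leq_addr.
rewrite -{1}(subnKC k0N) cos_sumD.
have := hN0 _ N0N; set a' := cos_sum q _ _ _ _ => h1.
set a := cos_sum q _ _ _ _.
have h2 : a <= k0%:R.
  by rewrite (le_trans (ler_norm _))// (le_trans (cos_sum_norm _ _ _ _ _)).
have h3 : (N - k0)%:R <= N%:R :> R by rewrite ler_nat leq_subr.
have h4 : 6 * e * (N - k0)%:R <= 6 * e * N%:R.
  by rewrite ler_wpM2l// mulr_ge0// ltW.
lra.
Qed.

End Decay.

(** * From Fourier decay to cosine averages *)

(** By the addition formula the integral is a combination of the real and imaginary parts of the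
    Fourier transform with coefficients of modulus at most 1, so [e / 2] for each part gives a bound
    uniform in [beta]. *)
Lemma rajchman_cos_decay (R : realType) (mu : probability (measurableTypeR R) R)
    (e : R) : rajchman mu -> 0 < e ->
  exists2 kappa, 0 < kappa & forall s beta, kappa <= `|s| ->
    \int[mu]_x cos (s * x + beta) <= e.
Proof.
move=> [/cvgrPdist_lt hp /cvgrPdist_lt hn] e0.
have e20 : 0 < e / 2 by lra.
have [M1 [_ hM1]] := hp _ e20; have [M2 [_ hM2]] := hn _ e20.
have pi0 : 0 < 2 * pi :> R by rewrite mulr_gt0// pi_gt0.
pose M := 1 + `|M1| + `|M2|.
have M1M : M1 < M by have := ler_norm M1; have := normr_ge0 M2; rewrite /M; lra.
have M2M : - M < M2.
  by have := ler_norm (- M2); rewrite normrN; have := normr_ge0 M1; rewrite /M; lra.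
have M0 : 0 < M by rewrite /M; have := normr_ge0 M1; have := normr_ge0 M2; lra.
exists (2 * pi * M); first by rewrite mulr_gt0.
move=> s beta s_large; pose q := s / (2 * pi).
have qE : 2 * pi * q = s by rewrite /q mulrC divfK// gt_eqF.
have qM : M <= `|q|.
  rewrite /q normrM normfV (gtr0_norm pi0) ler_pdivlMr//.
  by rewrite mulrC.
have small : ComplexField.Normc.normc (fourier_transform mu q) < e / 2.
  have n0 : 0 <= ComplexField.Normc.normc (fourier_transform mu q).
    by rewrite /ComplexField.Normc.normc sqrtr_ge0.
  rewrite -(ger0_norm n0) -normrN -[- _]sub0r.
  have [q0|q0] := leP 0 q.
    by apply: hM1; apply: lt_le_trans M1M _; rewrite -(ger0_norm q0).
  apply: hM2; apply: le_lt_trans M2M; rewrite lerNr.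
  by rewrite -(ltr0_norm q0).
move: small; rewrite /fourier_transform qE.
set a := \int[mu]_x cos (s * x); set b := \int[mu]_x sin (s * x) => small.
have aE : `|a| < e / 2.
  apply: le_lt_trans small; rewrite -sqrtr_sqr ler_wsqrtr//.
  by rewrite lerDl sqr_ge0.
have bE : `|b| < e / 2.
  apply: le_lt_trans small; rewrite -sqrtr_sqr ler_wsqrtr//.
  by rewrite lerDr sqr_ge0.
have ic : mu.-integrable setT (EFin \o (fun x => cos (s * x))).
  apply: (integrable_continuous_bounded _ (M := 1)); last by move=> x; exact: cos_max.
  move=> x; apply: continuous_comp; last exact: continuous_cos.
  by apply: cvgM; [exact: cvg_cst|exact: cvg_id].
have is_ : mu.-integrable setT (EFin \o (fun x => sin (s * x))).
  apply: (integrable_continuous_bounded _ (M := 1)); last by move=> x; exact: sin_max.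
  move=> x; apply: continuous_comp; last exact: continuous_sin.
  by apply: cvgM; [exact: cvg_cst|exact: cvg_id].
have -> : \int[mu]_x cos (s * x + beta) = cos beta * a - sin beta * b.
  rewrite -!RintegralZl// -RintegralB//.
  - by apply: eq_Rintegral => x _; rewrite cosD; ring.
  - exact: (integrableZl measurableT (cos beta) ic).
  - exact: (integrableZl measurableT (sin beta) is_).
have h1 : cos beta * a <= `|a|.
  by rewrite (le_trans (ler_norm _))// normrM ler_piMl// cos_max.
have h2 : - (sin beta * b) <= `|b|.
  by rewrite (le_trans (ler_norm _))// normrN normrM ler_piMl// sin_max.
lra.
Qed.

Lemma ae_cos_sum_le (R : realType) (mu : probability (measurableTypeR R) R)
    (q : nat) (s e : R) (theta : nat -> R) :
  self_similar_measure mu -> rajchman mu -> (2 <= q)%N -> s != 0 -> 0 < e ->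
  {ae mu, forall x : R, \forall N \near \oo, cos_sum q N s theta x <= e * N%:R}.
Proof.
move=> [n [r [t [p [[r0 r1 _] [p0 p1] mu_inv]]]]] mu_raj q2 s0 e0.
have [c c0 [b b01 rcb]] := ratio_bounds r0 r1.
have [K K0 suppK] := compact_support r0 r1 p0 p1 mu_inv.
(* The factor 7 is the loss in [ae_cos_sum_small]; the bound [2^-1] is required by the quadratic
   estimate of the exponential. *)
pose e' := Num.min (e / 7) 2^-1.
have e'0 : 0 < e' by rewrite lt_min; apply/andP; split; lra.
have e'2 : 0 < e' <= 2^-1 by rewrite e'0 ge_min lexx orbT.
have [kappa kappa0 decay] := rajchman_cos_decay mu_raj e'0.
pose L := (Num.bound (4 * K * (kappa / c) / e')).+1.
have L_large : 4 * K * (kappa / c) <= e' * L%:R.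
  rewrite [leRHS]mulrC -ler_pdivrMr//.
  have h0 : 0 <= 4 * K * (kappa / c) / e'.
    by rewrite !mulr_ge0// ?invr_ge0 ltW.
  by rewrite (le_trans (ltW (archi_boundP h0)))// ler_nat.
have := ae_cos_sum_small p0 c0 b01 rcb (integral_self_similar p0 mu_inv) K0 suppK
  q2 kappa0 decay e'2 (ltn0Sn _) L_large theta s0.
apply: (@filterS _ _ (ae_filter_ringOfSetsType mu)) => x [N0 _ hN0].
exists N0 => // N /hN0/le_trans; apply; rewrite ler_wpM2r//.
have : e' <= e / 7 by rewrite ge_min lexx.
lra.
Qed.

(** One null set must serve all phases, so only the countably many phases [j * (pi / 2)] and
    precisions [1 / (m + 1)] are used. Phases [j] and [j + 2] give opposite sums, hence a two-sided
    bound, and [j = 0, 1] generate every [theta] by the addition formula. *)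
Lemma ae_cos_average_cvg0 (R : realType) (mu : probability (measurableTypeR R) R) :
  self_similar_measure mu -> rajchman mu ->
  {ae mu, forall x : R, forall q, (2 <= q)%N -> forall k, (0 < k)%N -> forall theta,
    N%:R^-1 * (\sum_(i < N) cos (2 * pi * k%:R * (q%:R ^+ i * x) + theta))
      @[N --> \oo] --> 0}.
Proof.
move=> mu_ss mu_raj.
have base q k j m : {ae mu, forall x : R, (2 <= q)%N -> (0 < k)%N ->
    \forall N \near \oo, cos_sum q N (2 * pi * k%:R) (fun=> j%:R * (pi / 2)) x
      <= m.+1%:R^-1 * N%:R}.
  have [q2|] := leqP 2 q; last by move=> _; apply: aeW.
  have [->|k0] := posnP k; first exact: aeW.
  have s0 : 2 * pi * k%:R != 0 :> R.
    by rewrite !mulf_neq0// ?pnatr_eq0 -?lt0n// gt_eqF// pi_gt0.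
  have m0 : 0 < m.+1%:R^-1 :> R by rewrite invr_gt0.
  have := ae_cos_sum_le (fun=> j%:R * (pi / 2)) mu_ss mu_raj q2 s0 m0.
  by apply: (@filterS _ _ (ae_filter_ringOfSetsType mu)) => x.
have all_ae : {ae mu, forall x : R, forall q k j m, (2 <= q)%N -> (0 < k)%N ->
    \forall N \near \oo, cos_sum q N (2 * pi * k%:R) (fun=> j%:R * (pi / 2)) x
      <= m.+1%:R^-1 * N%:R}.
  by do 4 (apply: ae_foralln => ?); exact: base.
apply: (@filterS _ _ (ae_filter_ringOfSetsType mu) _ _ _ all_ae) => x hx q q2 k k0.
pose S j N := cos_sum q N (2 * pi * k%:R) (fun=> j%:R * (pi / 2)) x.
have S2 j N : S j.+2 N = - S j N.
  rewrite /S /cos_sum -sumrN; apply: eq_bigr => i _.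
  have -> : q%:R ^+ i * (2 * pi * k%:R) * x + j.+2%:R * (pi / 2) =
      q%:R ^+ i * (2 * pi * k%:R) * x + j%:R * (pi / 2) + pi.
    by rewrite -[j.+2]addn2 natrD; field.
  exact: cosDpi.
have cvgS j : N%:R^-1 * S j N @[N --> \oo] --> 0.
  apply/cvgrPdist_le => e e0.
  have h0 : 0 <= e^-1 by rewrite invr_ge0 ltW.
  pose m := Num.bound e^-1.
  have me : m.+1%:R^-1 <= e.
    rewrite -[e]invrK lef_pV2 ?posrE ?invr_gt0//.
    by rewrite (le_trans (ltW (archi_boundP h0)))// ler_nat.
  have h1 := hx q k j m q2 k0; have h2 := hx q k j.+2 m q2 k0.
  near=> N.
  have N0 : 0 < N%:R :> R by rewrite ltr0n; near: N; exact: nbhs_infty_gt.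
  have g1 : S j N <= m.+1%:R^-1 * N%:R by near: N; exact: h1.
  have g2 : S j.+2 N <= m.+1%:R^-1 * N%:R by near: N; exact: h2.
  rewrite sub0r normrN normrM normfV (gtr0_norm N0) ler_pdivrMl//.
  rewrite ler_norml -lerNl -S2 mulrC.
  apply/andP; split; [apply: le_trans g2 _|apply: le_trans g1 _];
    by rewrite ler_wpM2r// ltW.
move=> theta.
have -> : (fun N => N%:R^-1 *
      (\sum_(i < N) cos (2 * pi * k%:R * (q%:R ^+ i * x) + theta))) =
    (fun N => cos theta * (N%:R^-1 * S 0%N N) + sin theta * (N%:R^-1 * S 1%N N)).
  apply/funext => N; rewrite !(mulrCA _ N%:R^-1) -mulrDr; congr (_ * _).
  rewrite /S /cos_sum !mulr_sumr -big_split/=; apply: eq_bigr => i _.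
  rewrite mul0r addr0 mul1r cosDpihalf cosD.
  rewrite (_ : 2 * pi * k%:R * (q%:R ^+ i * x) = q%:R ^+ i * (2 * pi * k%:R) * x).
    by ring.
  by ring.
have cvgZS j (a : R) : a * (N%:R^-1 * S j N) @[N --> \oo] --> 0.
  by rewrite -(mulr0 a); apply: cvgM; [exact: cvg_cst|exact: cvgS].
by rewrite -[0]addr0; apply: cvgD; exact: cvgZS.
Unshelve. all: by end_near. Qed.

(** * Weyl's criterion *)

Section TrigPoly.
Context {R : realType}.
Implicit Types (f g : R -> R) (x a theta : R).

(** The phase covers sines and makes translates immediate; frequency 0 provides the constants. *)
Inductive trig_poly (d : nat) : (R -> R) -> Prop :=
| trig_cos k theta : (k <= d)%N -> trig_poly d (fun x => cos (2 * pi * k%:R * x + theta))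
| trig_add f g : trig_poly d f -> trig_poly d g -> trig_poly d (fun x => f x + g x)
| trig_scale a f : trig_poly d f -> trig_poly d (fun x => a * f x).

Lemma trig_poly_cst d a : trig_poly d (cst a).
Proof.
rewrite (_ : cst a = fun x => a * cos (2 * pi * 0%:R * x + 0)).
  by apply: trig_scale; exact: trig_cos.
by apply/funext => x; rewrite mulr0 mul0r addr0 cos0 mulr1.
Qed.

Lemma trig_poly_sum d (I : Type) (s : seq I) (F : I -> R -> R) :
  (forall i, trig_poly d (F i)) -> trig_poly d (fun x => \sum_(i <- s) F i x).
Proof.
move=> h; elim: s => [|i s IH].
  rewrite (_ : (fun x => _) = cst 0); first exact: trig_poly_cst.
  by apply/funext => x; rewrite big_nil.
rewrite (_ : (fun x => _) = fun x => F i x + \sum_(j <- s) F j x).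
  exact: trig_add.
by apply/funext => x; rewrite big_cons.
Qed.

Lemma trig_poly_shift d f a : trig_poly d f -> trig_poly d (fun x => f (x - a)).
Proof.
elim=> [k theta kd|g h _ IHg _ IHh|b g _ IHg]; last 2 first.
- exact: trig_add.
- exact: trig_scale.
rewrite (_ : (fun x => _) =
  fun x => cos (2 * pi * k%:R * x + (theta - 2 * pi * k%:R * a))).
  exact: trig_cos.
by apply/funext => x; congr cos; ring.
Qed.

Lemma trig_polyS d f : trig_poly d f -> trig_poly d.+1 f.
Proof.
elim=> [k theta kd|g h _ IHg _ IHh|b g _ IHg].
- by apply: trig_cos; exact: leqW.
- exact: trig_add.
- exact: trig_scale.
Qed.

Lemma trig_poly_mul_cos d f : trig_poly d f ->
  trig_poly d.+1 (fun x => f x * cos (2 * pi * x)).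
Proof.
elim=> [k theta kd|g h _ IHg _ IHh|b g _ IHg]; last 2 first.
- rewrite (_ : (fun x => _) =
    fun x => g x * cos (2 * pi * x) + h x * cos (2 * pi * x)).
    exact: trig_add.
  by apply/funext => x; rewrite mulrDl.
- rewrite (_ : (fun x => _) = fun x => b * (g x * cos (2 * pi * x))).
    exact: trig_scale.
  by apply/funext => x; rewrite mulrA.
have prod_cos (u v : R) : cos u * cos v = 2^-1 * (cos (u + v) + cos (u - v)).
  by rewrite cosD cosB; field.
(* Frequency 0 is separate because the product formula would produce the frequency [k - 1]. *)
case: k kd => [|k] kd.
  rewrite (_ : (fun x => _) =
    fun x => cos theta * cos (2 * pi * 1%:R * x + 0)).
    by apply: trig_scale; exact: trig_cos.
  by apply/funext => x; rewrite mulr0 mul0r add0r mulr1 addr0.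
rewrite (_ : (fun x => _) = fun x => 2^-1 *
   (cos (2 * pi * k.+2%:R * x + theta) + cos (2 * pi * k%:R * x + theta))).
  apply: trig_scale; apply: trig_add; apply: trig_cos => //.
  by rewrite (leq_trans _ (leqnSn d))// ltnW.
apply/funext => x; rewrite prod_cos; congr (_ * (cos _ + cos _)).
  by rewrite -[k.+2]addn1 natrD; ring.
by rewrite -[k.+1]addn1 natrD; ring.
Qed.

(** A nonnegative kernel of period 1 with peaks of height 1 at the integers; the square inside gives
    the recursion through [2 * cos^2 = 1 + cos] of the double angle. *)
Definition cos2n (n : nat) x : R := (cos (pi * x) ^+ 2) ^+ n.

Lemma trig_poly_cos2n n : trig_poly n (cos2n n).
Proof.
elim: n => [|n IH].
  rewrite (_ : cos2n 0 = cst 1); first exact: trig_poly_cst.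
  by apply/funext => x; rewrite /cos2n expr0.
rewrite (_ : cos2n n.+1 =
    fun x => 2^-1 * (cos2n n x + cos2n n x * cos (2 * pi * x))).
  apply: trig_scale; apply: trig_add; first exact: trig_polyS.
  exact: trig_poly_mul_cos.
apply/funext => x; rewrite /cos2n exprS -mulrA (mulr_natl (pi * x) 2) cos_mulr2n.
by rewrite -mulr_natl; field.
Qed.

Lemma cos2n_ge0 n x : 0 <= cos2n n x.
Proof. by rewrite exprn_ge0// sqr_ge0. Qed.

Lemma sum_cos_roots (k m : nat) theta : (0 < k < m)%N ->
  \sum_(j < m) cos (theta - 2 * pi * k%:R * (j%:R / m%:R)) = 0.
Proof.
move=> /andP[k0 km]; have m0 : (0 < m)%N by exact: leq_ltn_trans km.
have mR0 : 0 < m%:R :> R by rewrite ltr0n.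
pose b : R := pi * k%:R / m%:R.
have sb : sin b != 0.
  rewrite gt_eqF// sin_gt0_pi// /b divr_gt0 ?mulr_gt0 ?pi_gt0 ?ltr0n//=.
  by rewrite ltr_pdivrMr// ltr_pM2l ?pi_gt0// ltr_nat.
(* Multiplied by [sin b], the sum telescopes. *)
apply: (mulfI sb); rewrite mulr0.
pose G j := 2^-1 * sin (theta + b - 2 * b * j%:R).
have step j : sin b * cos (theta - 2 * pi * k%:R * (j%:R / m%:R)) = G j - G j.+1.
  rewrite /G (_ : theta - 2 * pi * k%:R * (j%:R / m%:R) = theta - 2 * b * j%:R).
    rewrite (_ : theta + b - _ = (theta - 2 * b * j%:R) + b); last by ring.
    rewrite (_ : theta + b - _ = (theta - 2 * b * j%:R) - b); last first.
      by rewrite -natr1; ring.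
    by move: (theta - _) => A; rewrite sinD sinB; field.
  by rewrite /b; field; rewrite gt_eqF.
rewrite mulr_sumr (eq_bigr (fun j : 'I_m => G j - G j.+1)) => [|j _]; last exact: step.
rewrite -(big_mkord xpredT (fun j => G j - G j.+1)).
rewrite (telescope_sumr_eq (fun j => - G j)) => [|//|j _]; last first.
  by rewrite opprK addrC.
(* The telescoped difference vanishes: [2 * b * m] equals [2 * pi * k], that is, [k] full
   periods. *)
rewrite opprK addrC /G mulr0 subr0 -mulrBr.
rewrite (_ : theta + b - 2 * b * m%:R = theta + b - (pi *+ 2) *+ k); last first.
  by rewrite /b -(mulr_natl _ k) -(mulr_natl pi 2); field; rewrite gt_eqF.
have := periodicn (@sinD2pi R) k (theta + b - (pi *+ 2) *+ k).
by rewrite subrK => ->; rewrite subrr mulr0.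
Qed.

Lemma trig_poly_sum_shifts d m f : (d < m)%N -> trig_poly d f ->
  exists C, forall x, \sum_(j < m) f (x - j%:R / m%:R) = C.
Proof.
move=> dm; elim=> [k theta kd|g h _ [C hC] _ [C' hC']|a g _ [C hC]]; last 2 first.
- by exists (C + C') => x; rewrite big_split/= hC hC'.
- by exists (a * C) => x; rewrite -mulr_sumr hC.
have [->|k0] := posnP k.
  exists (\sum_(j < m) cos theta) => x; apply: eq_bigr => j _.
  by rewrite mulr0 mul0r add0r.
exists 0 => x; rewrite -[RHS](@sum_cos_roots k m (2 * pi * k%:R * x + theta)).
  by apply: eq_bigr => j _; congr cos; ring.
by rewrite k0 (leq_ltn_trans kd).
Qed.

(** Bounds the total contribution of the [n + 1] kernel translates away from their peaks. One factor
    [g ^+ n] absorbs [n + 1], since [(n + 1) * g ^+ n] is at most the geometric sum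
    [1 + ... + g ^+ n]; the other tends to 0. *)
Lemma geometric_mul_small (g e : R) : 0 <= g < 1 -> 0 < e ->
  exists n : nat, n.+1%:R * (g ^+ 2) ^+ n <= e.
Proof.
move=> /andP[g0 g1] e0; have g1' : 0 < 1 - g by rewrite subr_gt0.
have h n : n.+1%:R * g ^+ n * (1 - g) <= 1 - g ^+ n.+1.
  elim: n => [|n IH]; first by rewrite expr0 !mul1r expr1.
  have p0 : 0 <= g ^+ n by rewrite exprn_ge0.
  have p1 : g ^+ n <= 1 by rewrite exprn_ile1// ltW.
  have : g * (n.+1%:R * g ^+ n * (1 - g)) <= g * (1 - g ^+ n.+1) by rewrite ler_wpM2l.
  rewrite -[n.+2%:R]natr1 !exprS.
  set y := g ^+ n in p0 p1 *; set N := n.+1%:R => H.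
  have gy : g * y <= 1 by rewrite mulr_ile1// ltW.
  have : 0 <= (1 - g) * (1 - g * y) by rewrite mulr_ge0 ?subr_ge0// ltW.
  by lra.
have [n _ hn] : \forall n \near \oo, `|0 - g ^+ n| < e * (1 - g).
  have /cvgrPdist_lt : GRing.exp g @ \oo --> 0.
    by apply: cvg_expr; rewrite ger0_norm.
  by apply; rewrite mulr_gt0.
exists n; have := hn n (leqnn n); have p0 : 0 <= g ^+ n by rewrite exprn_ge0.
rewrite sub0r normrN ger0_norm// => hlt.
rewrite -(ler_pM2r g1') (le_trans _ (ltW hlt))//.
rewrite -exprM mulnC exprM expr2 mulrA mulrAC ler_piMl//.
by rewrite (le_trans (h n))// gerBl exprn_ge0.
Qed.

Lemma unif_continuous01 f (e : R) : {within `[0, 1], continuous f} -> 0 < e ->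
  exists2 del, 0 < del & forall x y, 0 <= x <= 1 -> 0 <= y <= 1 ->
    `|x - y| < del -> `|f x - f y| <= e.
Proof.
move=> cf e0; have e20 : 0 < e / 2 by rewrite divr_gt0.
pose K := `[0, 1]%classic : set R.
have : near_covering K by apply/compact_near_coveringP; exact: segment_compact.
move=> /(_ R (0 : R)^'+ (fun del x => K x -> forall y, K y -> `|x - y| < del ->
  `|f x - f y| <= e) _) h.
have [del0 /= del00 hdel] : \forall del \near (0 : R)^'+, K `<=`
    (fun x => K x -> forall y, K y -> `|x - y| < del -> `|f x - f y| <= e).
  apply: h => x Kx.
  move/subspace_continuousP : cf => /(_ x Kx)/cvgrPdist_lt/(_ _ e20).
  rewrite near_withinE => -[d /= d0 hd].
  have d20 : 0 < d / 2 by rewrite divr_gt0.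
  exists (ball x (d / 2), [set del | del < d / 2]) => /=.
    split; first by apply: nbhsx_ballx.
    exact: nbhs_right_lt.
  move=> [x' del] [/= xx' hdel] Kx' y Ky x'y.
  have h1 : `|f x - f x'| < e / 2.
    by apply: hd => //=; rewrite (lt_trans xx')// ltr_pdivrMr// ltr_pMr// ltr1n.
  have h2 : `|f x - f y| < e / 2.
    apply: hd => //=; rewrite -(subrKA x') (le_lt_trans (ler_normD _ _))//.
    by rewrite [d]splitr ltrD//; exact: lt_trans hdel.
  rewrite -(subrKA (f x)) (le_trans (ler_normD _ _))// distrC [e]splitr.
  by rewrite lerD// ltW.
exists (del0 / 2); first by rewrite divr_gt0.
move=> x y Kx Ky xy; apply: (hdel (del0 / 2)) xy; rewrite /K/= ?in_itv//=.
- by rewrite sub0r normrN gtr0_norm ?divr_gt0// ltr_pdivrMr// ltr_pMr// ltr1n.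
- by rewrite divr_gt0.
Qed.

End TrigPoly.

(** * Convergence of averages along a sequence *)

Section Weyl.
Context {R : realType} (u : nat -> R).
Implicit Types (f g h : R -> R).

Local Notation integral01 f := (\int[lebesgue_measure]_(x in `[0, 1]) f x).

Definition averages_to_integral f : Prop :=
  N%:R^-1 * (\sum_(i < N) f (u i)) @[N --> \oo] --> integral01 f.

Lemma integrable01 f : {within `[0, 1], continuous f} ->
  (@lebesgue_measure R).-integrable `[0, 1] (EFin \o f).
Proof. by apply: continuous_compact_integrable; exact: segment_compact. Qed.

Lemma Rintegral01_FTC (F f : R -> R) : (forall x : R, is_derive x (1 : R) F (f x)) ->
  continuous f -> integral01 f = F 1 - F 0.
Proof.
move=> dF cf; have cF : continuous F.
  by move=> x; apply/differentiable_continuous/derivable1_diffP; case: (dF x).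
rewrite /Rintegral (@continuous_FTC2 _ f F)//.
- by apply: continuous_subspaceT.
- split.
  + by move=> x _; case: (dF x).
  + by apply: cvg_at_right_filter; exact: cF.
  + by apply: cvg_at_left_filter; exact: cF.
- by move=> x _; rewrite derive1E; apply: derive_val.
Qed.

Lemma Rintegral01_cos (k : nat) (theta : R) : (0 < k)%N ->
  integral01 (fun x => cos (2 * pi * k%:R * x + theta)) = 0.
Proof.
move=> k0; pose a : R := 2 * pi * k%:R.
have a0 : a != 0 by rewrite !mulf_neq0// ?pnatr_eq0 -?lt0n// gt_eqF// pi_gt0.
have dF (x : R) : is_derive x (1 : R) (fun x => a^-1 * sin (a * x + theta))
    (cos (a * x + theta)).
  have d1 : is_derive x (1 : R) (fun x => a * x + theta) a.
    have d0 := @is_deriveZ _ _ _ _ a x 1 _ (is_derive_id x 1).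
    have := @is_deriveD _ _ _ _ (cst theta) x 1 _ _ d0 (is_derive_cst theta x 1).
    by rewrite addr0 /GRing.scale/= mulr1.
  have d2 := @is_derive1_comp R sin _ x _ _ (is_derive_sin _) d1.
  have := @is_deriveZ _ _ _ _ a^-1 x 1 _ d2.
  by rewrite /GRing.scale/= mulrCA mulVf// mulr1.
rewrite (Rintegral01_FTC dF); last exact: continuous_cos_affine.
rewrite mulr1 mulr0 add0r (_ : a + theta = theta + (pi *+ 2) *+ k).
  by rewrite (periodicn (@sinD2pi R)) subrr.
by rewrite /a -(mulr_natl _ k) -(mulr_natl pi 2); ring.
Qed.

Lemma Rintegral01_exprn (n : nat) : integral01 (fun x : R => x ^+ n) = n.+1%:R^-1 :> R.
Proof.
have dF (x : R) : is_derive x (1 : R) (fun x => n.+1%:R^-1 * x ^+ n.+1) (x ^+ n).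
  have dX : is_derive (x : R) (1 : R) (fun x : R => x ^+ n.+1) (n.+1%:R * x ^+ n).
    apply: DeriveDef; first exact: exprn_derivable.
    by rewrite exp_derive /GRing.scale/= mulr1.
  have := @is_deriveZ _ _ _ _ n.+1%:R^-1 x 1 _ dX.
  by rewrite /GRing.scale/= mulKf// pnatr_eq0.
rewrite (Rintegral01_FTC dF); last exact: exprn_continuous.
by rewrite expr1n expr0n mulr1 mulr0 subr0.
Qed.

Lemma trig_poly_continuous d f : trig_poly d f -> continuous f.
Proof.
elim=> [k theta kd|g h _ IHg _ IHh|b g _ IHg] x.
- exact: continuous_cos_affine.
- by apply: cvgD; [exact: IHg|exact: IHh].
- by apply: cvgM; [exact: cvg_cst|exact: IHg].
Qed.

Hypothesis u01 : forall i, 0 <= u i <= 1.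

Lemma averages_cst (c : R) : averages_to_integral (cst c).
Proof.
rewrite /averages_to_integral Rintegral_cst//= lebesgue_measure_itv/= lte_fin ltr01.
rewrite sube0 mulr1; apply: cvg_near_cst; near=> N.
have N0 : N%:R != 0 :> R.
  by rewrite pnatr_eq0 -lt0n; near: N; exact: nbhs_infty_gt.
by rewrite sumr_const card_ord -(mulr_natl c) mulKf.
Unshelve. all: by end_near. Qed.

Lemma averages_add f g : continuous f -> continuous g ->
  averages_to_integral f -> averages_to_integral g ->
  averages_to_integral (fun x => f x + g x).
Proof.
move=> cf cg af ag; rewrite /averages_to_integral RintegralD//; last 2 first.
- by apply: integrable01; exact: continuous_subspaceT.
- by apply: integrable01; exact: continuous_subspaceT.
under eq_fun do rewrite big_split/= mulrDr.
exact: cvgD.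
Qed.

Lemma averages_scale f (c : R) : continuous f ->
  averages_to_integral f -> averages_to_integral (fun x => c * f x).
Proof.
move=> cf af; rewrite /averages_to_integral RintegralZl//; last first.
  by apply: integrable01; exact: continuous_subspaceT.
under eq_fun do rewrite -mulr_sumr mulrCA.
by apply: cvgM; [exact: cvg_cst|exact: af].
Qed.

(* [f] may be replaced by [g] up to an error whose averages are also
   controlled; this is how uniform approximation and the correction at the
   endpoints are both handled. *)
Lemma averages_sandwich f : {within `[0, 1], continuous f} ->
  (forall e, 0 < e -> exists g h,
    [/\ {within `[0, 1], continuous g}, {within `[0, 1], continuous h},
      averages_to_integral g, averages_to_integral h &
      (forall x, 0 <= x <= 1 -> `|f x - g x| <= h x) /\ integral01 h <= e]) ->
  averages_to_integral f.
Proof.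
move=> cf approx; apply/cvgrPdist_le => e e0.
have e40 : 0 < e / 4 by rewrite divr_gt0.
have [g [h [cg ch /cvgrPdist_le ag /cvgrPdist_le ah [fgh he]]]] := approx _ e40.
have ag' := ag _ e40; have ah' := ah _ e40.
have int_fg : `|integral01 f - integral01 g| <= integral01 h.
  rewrite -RintegralB//; [|exact: integrable01|exact: integrable01].
  have ifg : (@lebesgue_measure R).-integrable `[0, 1] (EFin \o (fun x => f x - g x)).
    exact: (integrableB _ (integrable01 cf) (integrable01 cg)).
  apply: (le_trans (le_normr_Rintegral _ ifg)) => //.
  apply: le_Rintegral => //.
  - exact: integrable_norm ifg.
  - exact: integrable01.
near=> N.
have NR : 0 <= N%:R^-1 :> R by rewrite invr_ge0.
have g1 : `|integral01 g - N%:R^-1 * \sum_(i < N) g (u i)| <= e / 4 by near: N.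
have h1 : `|integral01 h - N%:R^-1 * \sum_(i < N) h (u i)| <= e / 4 by near: N.
have fg1 : `|N%:R^-1 * (\sum_(i < N) f (u i)) - N%:R^-1 * (\sum_(i < N) g (u i))|
    <= N%:R^-1 * \sum_(i < N) h (u i).
  rewrite -mulrBr normrM ger0_norm// ler_wpM2l// -sumrB.
  rewrite (le_trans (ler_norm_sum _ _ _))//.
  by apply: ler_sum => i _; exact: fgh.
move: int_fg g1 h1 fg1 he.
move: (integral01 f) (integral01 g) (integral01 h) => I J H.
move: (_ * \sum_(i < N) f (u i)) (_ * \sum_(i < N) g (u i)) => a b.
move: (_ * \sum_(i < N) h (u i)) => c.
rewrite !ler_norml => /andP[? ?] /andP[? ?] /andP[? ?] /andP[? ?] ?.
by apply/andP; split; lra.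
Unshelve. all: by end_near. Qed.

Hypothesis weyl : forall k, (0 < k)%N -> forall theta,
  N%:R^-1 * (\sum_(i < N) cos (2 * pi * k%:R * u i + theta)) @[N --> \oo] --> 0.

Lemma averages_trig_poly d f : trig_poly d f -> averages_to_integral f.
Proof.
elim=> [k theta kd|g h tg IHg th IHh|b g tg IHg].
- have [->|k0] := posnP k.
    rewrite (_ : (fun x => _) = cst (cos theta)); first exact: averages_cst.
    by apply/funext => x; rewrite mulr0 mul0r add0r.
  by rewrite /averages_to_integral Rintegral01_cos//; exact: weyl.
- apply: averages_add => //; first exact: trig_poly_continuous tg.
  exact: trig_poly_continuous th.
- by apply: averages_scale => //; exact: trig_poly_continuous tg.
Qed.

End Weyl.

(** * Uniform approximation of periodic functions *)

Section Approximation.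
Context {R : realType}.
Implicit Types (f : R -> R) (x y : R).

(** Cosine decreases on [[0, pi]] and changes sign under reflection at [pi / 2], so [|cos (pi * t)|]
    is largest at the ends of the range of [|t|]. The upper end [1 - del] keeps away from the
    neighbouring peak. *)
Lemma cos2n_far (n : nat) (del t : R) : 0 < del -> del <= 2^-1 ->
  del <= `|t| <= 1 - del -> cos2n n t <= (cos (pi * del) ^+ 2) ^+ n.
Proof.
move=> d0 d2 /andP[td td1]; have pi0 : 0 < pi :> R by exact: pi_gt0.
have c0 : 0 <= cos (pi * del).
  have h0 : 0 <= pi * del by rewrite mulr_ge0// ltW.
  have h1 : pi * del <= pi / 2 by rewrite ler_pM2l.
  by apply: cos_ge0_pihalf; apply/andP; split; lra.
apply: lerXn2r; rewrite ?nnegrE ?sqr_ge0//.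
rewrite -(real_normK (num_real (cos (pi * t)))) lerXn2r ?nnegrE//.
have -> : cos (pi * t) = cos (pi * `|t|).
  by rewrite -(cos_norm (pi * t)) normrM gtr0_norm.
have mono (a b : R) : 0 <= a -> a <= b -> b <= 1 -> cos (pi * b) <= cos (pi * a).
  move=> a0 ab b1; rewrite leNgt; apply/negP => lt_cos.
  have in_pi (z : R) : 0 <= z <= 1 -> pi * z \in `[0, pi]%R.
    move=> /andP[z0 z1].
    rewrite in_itv/=; apply/andP; split; first exact: mulr_ge0 (ltW pi0) z0.
    by apply: ler_piMr => //; exact: ltW.
  have : pi * b < pi * a.
    by rewrite -ltr_cos ?in_pi ?(le_trans a0 ab) ?a0 ?(le_trans ab b1).
  by rewrite ltr_pM2l// ltNge ab.
rewrite ler_norml; apply/andP; split; last by apply: mono; lra.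
rewrite lerNl (_ : - cos (pi * `|t|) = cos (pi * (1 - `|t|))).
  by apply: mono; lra.
by rewrite mulrBr mulr1 cosB cospi sinpi mul0r addr0 mulN1r.
Qed.

End Approximation.

(* The approximant is a discrete convolution of [f] with the kernel
   [cos (pi x) ^ 2n] over the (n+1)-st roots of unity; the total mass [W] of the
   translated kernels is constant because averaging over these roots kills the
   frequencies [1, ..., n]. *)
Lemma trig_poly_dense (R : realType) (f : R -> R) (e : R) :
  {within `[0, 1], continuous f} -> f 0 = f 1 -> 0 < e ->
  exists d P, trig_poly d P /\ forall x, 0 <= x <= 1 -> `|f x - P x| <= e.
Proof.
move=> cf f01 e0; have e40 : 0 < e / 4 by rewrite divr_gt0.
have [M M0 fM] : exists2 M, 0 < M & forall x, 0 <= x <= 1 -> `|f x| <= M.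
  have [a _ ha] := EVT_max ler01 cf; have [b _ hb] := EVT_min ler01 cf.
  exists (1 + `|f a| + `|f b|).
    by have := normr_ge0 (f a); have := normr_ge0 (f b); lra.
  move=> x x01; have xI : x \in `[0, 1]%R by rewrite in_itv.
  have := ha x xI; have := hb x xI; have := ler_norm (f a).
  have := ler_norm (- f b); rewrite normrN.
  have := normr_ge0 (f a); have := normr_ge0 (f b).
  by move=> *; rewrite ler_norml; apply/andP; split; lra.
have [del0 del00 fdel] := unif_continuous01 cf e40.
pose del := Num.min del0 2^-1.
have del_gt0 : 0 < del by rewrite lt_min del00 invr_gt0 ltr0n.
have del_half : del <= 2^-1 by rewrite ge_min lexx orbT.
have del_le : del <= del0 by rewrite ge_min lexx.
pose g := cos (pi * del).
have pi0 : 0 < pi :> R by exact: pi_gt0.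
have g01 : 0 <= g < 1.
  have h0 : 0 < pi * del by rewrite mulr_gt0.
  have h1 : pi * del <= pi / 2 by rewrite ler_pM2l.
  apply/andP; split; first by apply: cos_ge0_pihalf; apply/andP; split; lra.
  by rewrite /g -cos0 ltr_cos// in_itv/=; apply/andP; split; lra.
(* With this precision the far terms, each at most [2 * M * (g ^+ 2) ^+ n], sum to at most
   [e / 2]. *)
have eM : 0 < e / (4 * M) by rewrite divr_gt0// mulr_gt0.
have [n hn] := geometric_mul_small g01 eM.
have [W hW] := trig_poly_sum_shifts (ltnSn n) (@trig_poly_cos2n R n).
(* At [x = 0] the translate by 0 alone contributes 1. This lower bound absorbs the far terms:
   [e / 2 * W + e / 2 <= e * W]. *)
have W1 : 1 <= W.
  rewrite -(hW 0) (bigD1 ord0)//= mul0r subr0 {1}/cos2n mulr0 cos0 !expr1n.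
  by rewrite lerDl sumr_ge0// => j _; exact: cos2n_ge0.
have W0 : 0 < W by exact: lt_le_trans W1.
pose y (j : 'I_n.+1) : R := j%:R / n.+1%:R.
have y01 j : 0 <= y j <= 1.
  by rewrite /y divr_ge0//= ler_pdivrMr// mul1r ler_nat ltnW.
(* Either [x] and [z] are far apart on the circle and the kernel is small, or they are close there
   and [f] varies little; if they are close across the endpoint, [f 0 = f 1] joins two steps of size
   [e / 4]. *)
have key (x z : R) : 0 <= x <= 1 -> 0 <= z <= 1 ->
    `|f x - f z| * cos2n n (x - z) <= e / 2 * cos2n n (x - z) + 2 * M * (g ^+ 2) ^+ n.
  move=> x01 z01; have w0 := cos2n_ge0 n (x - z).
  have gn0 : 0 <= 2 * M * (g ^+ 2) ^+ n.
    by apply: mulr_ge0; [apply: mulr_ge0 => //; exact: ltW|exact/exprn_ge0/sqr_ge0].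
  have [close|far] : `|f x - f z| <= e / 2 \/ del <= `|x - z| <= 1 - del.
    have [xz|xz] := ltP `|x - z| del.
      left; have := fdel x z x01 z01 (lt_le_trans xz del_le); lra.
    have [xz1|xz1] := leP `|x - z| (1 - del); first by right; apply/andP.
    left; have [/andP[x0 x1] /andP[z0 z1]] := (x01, z01).
    have i0 : 0 <= (0 : R) <= 1 by rewrite lexx ler01.
    have i1 : 0 <= (1 : R) <= 1 by rewrite lexx ler01.
    have [xz'|xz'] := leP z x.
      rewrite ger0_norm ?subr_ge0// in xz1.
      have h1 : `|f x - f 1| <= e / 4.
        by apply: fdel => //; rewrite ltr_norml; apply/andP; split; lra.
      have h2 : `|f 0 - f z| <= e / 4.
        by apply: fdel => //; rewrite ltr_norml; apply/andP; split; lra.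
      have -> : f x - f z = (f x - f 1) + (f 0 - f z) by rewrite f01; ring.
      by rewrite (le_trans (ler_normD _ _))//; lra.
    rewrite distrC ger0_norm ?subr_ge0 1?ltW// in xz1.
    have h1 : `|f x - f 0| <= e / 4.
      by apply: fdel => //; rewrite ltr_norml; apply/andP; split; lra.
    have h2 : `|f 1 - f z| <= e / 4.
      by apply: fdel => //; rewrite ltr_norml; apply/andP; split; lra.
    have -> : f x - f z = (f x - f 0) + (f 1 - f z) by rewrite f01; ring.
    by rewrite (le_trans (ler_normD _ _))//; lra.
  - by rewrite (le_trans (ler_wpM2r w0 close))// lerDl.
  - have hw := cos2n_far n del_gt0 del_half far.
    have h2M : `|f x - f z| <= 2 * M.
      by rewrite (le_trans (ler_normB _ _))//; have := fM x x01; have := fM z z01; lra.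
    apply: (le_trans (ler_pM (normr_ge0 _) w0 h2M hw)).
    by rewrite lerDr mulr_ge0// ltW// divr_gt0.
exists n, (fun x => W^-1 * \sum_(j < n.+1) f (y j) * cos2n n (x - y j)); split.
  apply: trig_scale; apply: trig_poly_sum => j; apply: trig_scale.
  by apply: trig_poly_shift; exact: trig_poly_cos2n.
move=> x x01; rewrite -{1}(mulKf (lt0r_neq0 W0) (f x)) -mulrBr normrM.
rewrite gtr0_norm ?invr_gt0// ler_pdivrMl// -{1}(hW x) mulr_suml -sumrB.
apply: (le_trans (ler_norm_sum _ _ _)).
apply: (@le_trans _ _ (\sum_(j < n.+1)
    (e / 2 * cos2n n (x - y j) + 2 * M * (g ^+ 2) ^+ n))).
  apply: ler_sum => j _.
  rewrite [f (y j) * _]mulrC -mulrBr normrM mulrC (ger0_norm (cos2n_ge0 _ _)).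
  exact: key.
rewrite big_split/= -mulr_sumr hW sumr_const card_ord.
have : 2 * M * (n.+1%:R * (g ^+ 2) ^+ n) <= e / 2.
  apply: (le_trans (ler_wpM2l _ hn)); first by rewrite mulr_ge0// ltW.
  by rewrite le_eqVlt; apply/orP; left; apply/eqP; field; rewrite gt_eqF.
rewrite mulrCA -mulr_natl; nra.
Qed.

Lemma weyl_criterion (R : realType) (u : nat -> R) :
  (forall i, 0 <= u i <= 1) ->
  (forall k, (0 < k)%N -> forall theta,
    N%:R^-1 * (\sum_(i < N) cos (2 * pi * k%:R * u i + theta)) @[N --> \oo] --> 0) ->
  equidistributed01 u.
Proof.
move=> u01 weyl.
have periodic (f : R -> R) : {within `[0, 1], continuous f} -> f 0 = f 1 ->
    averages_to_integral u f.
  move=> cf f01; apply: averages_sandwich => // e e0.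
  have [d [P [tP fP]]] := trig_poly_dense cf f01 e0.
  exists P, (cst e); split.
  - by apply: continuous_subspaceT; exact: trig_poly_continuous tP.
  - by apply: continuous_subspaceT => x; exact: cvg_cst.
  - exact: averages_trig_poly tP.
  - exact: averages_cst.
  - split; first exact: fP.
    by rewrite Rintegral_cst//= lebesgue_measure_itv/= lte_fin ltr01 sube0 mulr1.
move=> f cf; apply: averages_sandwich => // e e0.
(* [f] need not satisfy [f 0 = f 1]: adding [D (1 - x)^n] makes it periodic, and
   the error is dominated by the periodic function [|D| (x^n + (1 - x)^n)], whose
   integral is small. *)
pose D := f 1 - f 0.
have D0 : 0 <= `|D| by [].
(* The dominating function has integral [2 * |D| / (n + 1)]; the successor makes [n] positive, so
   that [0 ^+ n] vanishes. *)
pose n := (Num.bound (2 * `|D| / e)).+1.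
pose b (x : R) := (1 - x) ^+ n.
have cb : continuous b.
  move=> x; apply: (@continuous_comp _ _ _ (fun x : R => 1 - x) (fun x => x ^+ n)).
    by apply: cvgB; [exact: cvg_cst|exact: cvg_id].
  exact: exprn_continuous.
have cX : continuous (fun x : R => x ^+ n) by exact: exprn_continuous.
have b0 : b 0 = 1 by rewrite /b subr0 expr1n.
have b1 : b 1 = 0 by rewrite /b subrr expr0n.
exists (fun x => f x + D * b x), (fun x => `|D| * (x ^+ n + b x)); split.
- move=> x; apply: cvgD; first exact: cf.
  apply: (@continuous_subspaceT _ _ _ (fun x => D * b x)) => z.
  by apply: cvgM; [exact: cvg_cst|exact: cb].
- apply: continuous_subspaceT => z.
  by apply: cvgM; [exact: cvg_cst|apply: cvgD; [exact: cX|exact: cb]].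
- apply: periodic; last by rewrite b0 b1 /D; ring.
  move=> x; apply: cvgD; first exact: cf.
  apply: (@continuous_subspaceT _ _ _ (fun x => D * b x)) => z.
  by apply: cvgM; [exact: cvg_cst|exact: cb].
- apply: periodic; last by rewrite b0 b1 expr1n expr0n add0r addr0.
  apply: continuous_subspaceT => z.
  by apply: cvgM; [exact: cvg_cst|apply: cvgD; [exact: cX|exact: cb]].
- split.
    move=> x /andP[x0 x1]; rewrite opprD addrA subrr add0r normrN normrM.
    rewrite ler_wpM2l// ger0_norm ?lerDr ?exprn_ge0// subr_ge0//.
  have ib : (@lebesgue_measure R).-integrable `[0, 1] (EFin \o b).
    by apply: integrable01; exact: continuous_subspaceT.
  have iX : (@lebesgue_measure R).-integrable `[0, 1] (EFin \o (fun x => x ^+ n)).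
    by apply: integrable01; exact: continuous_subspaceT.
  rewrite RintegralZl//; last first.
    apply: integrable01; apply: continuous_subspaceT => z.
    by apply: cvgD; [exact: cX|exact: cb].
  rewrite RintegralD// Rintegral01_exprn Rintegral_onemXn.
  have n0 : 0 < n.+1%:R :> R by [].
  have h0 : 0 <= 2 * `|D| / e by rewrite divr_ge0 ?mulr_ge0// ltW.
  have h1 : 2 * `|D| / e <= n.+1%:R.
    by rewrite (le_trans (ltW (archi_boundP h0)))// ler_nat /n ltnW.
  rewrite (_ : `|D| * _ = 2 * `|D| / n.+1%:R); last by ring.
  by rewrite ler_pdivrMr// [leRHS]mulrC -ler_pdivrMr.
Qed.

(** * Orbits of multiplication modulo one *)

Lemma cosD2piz (R : realType) (a : R) (z : int) : cos (a + 2 * pi * z%:~R) = cos a.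
Proof.
have pos (n : nat) (b : R) : cos (b + 2 * pi * n%:R) = cos b.
  rewrite -[RHS](periodicn (@cosD2pi R) n b) -(mulr_natl _ n) -(mulr_natl pi 2).
  by congr cos; ring.
case: z => n; first exact: pos.
by rewrite NegzE mulrNz mulrN -[LHS](pos n.+1) -pmulrn subrK.
Qed.

Lemma iter_times_mod1 (R : realType) (p k : nat) (x : R) :
  exists z : int, iter k (times_mod1 p) x = p%:R ^+ k * x + z%:~R.
Proof.
elim: k => [|k [z IH]]; first by exists 0; rewrite expr0 mul1r addr0.
rewrite iterS IH /times_mod1; set fl := Num.floor _.
exists (p%:Z * z - fl); rewrite intrB intrM exprS -[(p%:Z)%:~R]/(p%:R : R).
by ring.
Qed.

Lemma subr_floor01 (R : realType) (x : R) : 0 <= x - (Num.floor x)%:~R <= 1.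
Proof.
have /andP[h1] := floor_itv x; rewrite intrD => h2.
by apply/andP; split; lra.
Qed.

(** Changing the initial term alters the average by a constant over [N]. This allows for an orbit
    that starts outside [[0, 1]], where test functions are unconstrained. *)
Lemma equidistributed01_eq_tail (R : realType) (u v : nat -> R) :
  (forall k, u k.+1 = v k.+1) -> equidistributed01 u -> equidistributed01 v.
Proof.
move=> uv eu f cf.
rewrite (_ : (fun N => _) = fun N => N%:R^-1 * (\sum_(k < N) f (u k))
    + N%:R^-1 * (if N is 0 then 0 else f (v 0%N) - f (u 0%N))); last first.
  apply/funext => -[|N]; first by rewrite !big_ord0 !mulr0 addr0.
  rewrite -mulrDr !big_ord_recl; congr (_ * _).
  by under eq_bigr do rewrite /= -uv; rewrite /=; ring.
rewrite -[X in _ --> X]addr0; apply: cvgD; first exact: eu.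
apply/cvgrPdist_le => e e0; set c := f (v 0%N) - f (u 0%N).
have h0 : 0 <= `|c| / e by rewrite divr_ge0// ltW.
exists (Num.bound (`|c| / e)).+1 => // -[|N]//= hN.
rewrite sub0r normrN normrM normfV [`|_%:R|]ger0_norm// ler_pdivrMl//.
rewrite -ler_pdivrMr// (le_trans (ltW (archi_boundP h0)))// ler_nat.
exact: ltnW.
Qed.

Lemma normal_in_base_of_averages (R : realType) (p : nat) (x : R) :
  (forall k, (0 < k)%N -> forall theta,
    N%:R^-1 * (\sum_(i < N) cos (2 * pi * k%:R * (p%:R ^+ i * x) + theta))
      @[N --> \oo] --> 0) ->
  normal_in_base p x.
Proof.
(* The starting point is replaced by its fractional part; every term is then in [[0, 1]] and still
   differs from [p ^ i * x] by an integer. *)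
move=> hx; pose v i := if i is i'.+1 then iter i (times_mod1 p) x
                       else x - (Num.floor x)%:~R.
apply: (@equidistributed01_eq_tail _ v) => //; apply: weyl_criterion.
  by case=> [|i]; exact: subr_floor01.
move=> k k0 theta; have vE i : exists z : int, v i = p%:R ^+ i * x + z%:~R.
  case: i => [|i]; last exact: iter_times_mod1.
  by exists (- Num.floor x); rewrite expr0 mul1r intrN.
rewrite (_ : (fun N => _) = fun N => N%:R^-1 *
    (\sum_(i < N) cos (2 * pi * k%:R * (p%:R ^+ i * x) + theta))).
  exact: hx.
apply/funext => N; congr (_ * _); apply: eq_bigr => i _.
have [z ->] := vE i.
rewrite -[RHS](cosD2piz _ (k%:Z * z)) intrM -[(k%:Z)%:~R]/(k%:R : R).
by congr cos; ring.
Qed.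

Theorem theorem1p4 (R : realType) (mu : probability (measurableTypeR R) R)
    (mu_ss : self_similar_measure mu) (mu_raj : rajchman mu) :
  pointwise_absolutely_normal mu.
Proof.
apply: (@filterS _ _ (ae_filter_ringOfSetsType mu) _ _ _
  (ae_cos_average_cvg0 mu_ss mu_raj)) => x hx p p2.
by apply: normal_in_base_of_averages; exact: hx.
Qed.
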